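(* $\Delta=\mathrm{non}(\mathcal M)$ and $\hat\Delta=\mathrm{cov}(\mathcal M)$.
   Context: $[\omega]^\omega$ is the set of infinite subsets of $\omega$ and $\mathrm{Sym}(\omega)$ the set of permutations of $\omega$. $\Delta$ is the least cardinality of a family $\Pi\subseteq\mathrm{Sym}(\omega)$ such that for all $x\in[\omega]^\omega$ there is $\pi\in\Pi$ such that the set $\{n\in x: n\ne\pi(n)\in x\}$ is infinite. $\hat\Delta$ is the least cardinality of a family $X\subseteq[\omega]^\omega$ such that for all $\pi\in\mathrm{Sym}(\omega)$ there is $x\in X$ such that the set $\{n\in x:n\ne\pi(n)\in x\}$ is finite. $\mathcal M$ is the meager ideal on $2^\omega$, $\mathrm{non}(\mathcal M)$ is the least size of a nonmeager set of reals, and $\mathrm{cov}(\mathcal M)$ is the least size of a family of meager sets covering $2^\omega$. *)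

(* Defs.v *)
From mathcomp Require Import all_boot all_order all_algebra.
From mathcomp Require Import all_classical all_reals all_analysis.

Set Implicit Arguments.
Unset Strict Implicit.
Unset Printing Implicit Defensive.

Local Open Scope classical_set_scope.
Local Open Scope card_scope.

(* A member of P whose cardinality is least among the members of P.  There is
   no type of cardinal numbers here, so "the least cardinality of a member of P"
   is represented by such a witness; its cardinality does not depend on the
   witness chosen, by attains_least_card_eq. *)
Definition attains_least_card {T : Type} (P : set (set T)) (A : set T) : Prop :=
  P A /\ forall B : set T, P B -> A #<= B.

Lemma attains_least_card_eq {T : Type} (P : set (set T)) (A B : set T) :
  attains_least_card P A -> attains_least_card P B -> A #= B.
Proof.
by move=> [PA leA] [PB leB]; rewrite card_eq_le (leA _ PB) (leB _ PA).
Qed.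

(* Equality of two least cardinalities; both are asserted to exist. *)
Definition same_least_card {T U : Type} (P : set (set T)) (Q : set (set U))
    : Prop :=
  exists (A : set T) (B : set U),
    [/\ attains_least_card P A, attains_least_card Q B & A #= B].

Definition infinite_subsets : set (set nat) := [set x | infinite_set x].

Definition Sym_omega : set (nat -> nat) := [set p | bijective p].

Definition displaced_within (p : nat -> nat) (x : set nat) : set nat :=
  [set n | [/\ x n, n <> p n & x (p n)]].

Definition Delta_family (Pi : set (nat -> nat)) : Prop :=
  Pi `<=` Sym_omega /\
  forall x : set nat, infinite_subsets x ->
    exists2 p, Pi p & infinite_set (displaced_within p x).

Definition hatDelta_family (X : set (set nat)) : Prop :=
  X `<=` infinite_subsets /\
  forall p : nat -> nat, Sym_omega p ->
    exists2 x, X x & finite_set (displaced_within p x).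

Definition nowhere_dense {T : topologicalType} (A : set T) : Prop :=
  interior (closure A) = set0.

Definition meager {T : topologicalType} (A : set T) : Prop :=
  exists2 F : nat -> set T,
    forall n, nowhere_dense (F n) & A = \bigcup_n F n.

Definition nonmeager_set (A : set cantor_space) : Prop := ~ meager A.

Definition meager_cover (C : set (set cantor_space)) : Prop :=
  (forall A, C A -> meager A) /\ \bigcup_(A in C) A = setT.

(* Main.v *)
Require Import Defs.
From mathcomp Require Import all_boot all_order all_algebra.
From mathcomp Require Import all_classical all_reals all_analysis.
From mathcomp Require Import zify.

(** The four inequalities behind the two equalities are proved by maps that do
    not mention cardinals, so each map serves once for the families and once,
    dually, for the covers; [same_least_card_of_le] then assembles them.

    In one direction permutations are read off from points.  A point [z] of the Cantor space lists
    candidate transpositions, and [matching_perm z] performs those that do not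
    clash with an earlier one.  For a fixed infinite [x], every finite
    condition on [z] extends to one forcing a new transposition inside [x], so
    the [z] whose permutation displaces only finitely many points within [x]
    form a meager set ([meager_matching]).  Hence a nonmeager set of [z] yields
    a family witnessing Delta, and a family witnessing hatDelta yields a meager
    cover.

    Conversely, a permutation predicts functions.  A function [g] codes a
    sparse set: its next element is the code of a tuple of values of [g], where
    the tuple is indexed by the elements already chosen, two positions for each
    of them.  If [p] sends one element of the set to another, the later of the
    two is the image or preimage of an earlier one, so [p] and the history of
    the set determine the tuple up to the choice of a position; reading off the
    diagonal, [p] guesses a value of [g] correctly.  Thus infinitely many
    displaced points give infinitely many correct guesses ([guess_displaced]).

    Infinitely many correct guesses are then turned into a point outside a
    given meager set, after Bartoszynski.  A meager set is contained in
    a set of the form [evading x u] ([meager_evading]), the points that on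
    almost all intervals [[m, u m)] differ from [x].  A first guess, of
    [u \o u], yields an interval partition which infinitely often has a block
    as long as [u] requires ([cuts_long]).  A second guess predicts [x] on the
    blocks; it has to be right on infinitely many of the long blocks, which is
    achieved by guessing many values at once ([partial_code_agree]).  Splicing
    the predicted blocks gives a point that is not in [evading x u]
    ([spliced_not_evading]).

    The second guess depends on the partition found by the first.  For a cover
    this is harmless, as each guess is made for all its members at once.  For
    a family [Pi] the spliced points are indexed by [Pi `*` Pi], so the
    equality of an infinite cardinal with its square is needed
    ([card_square_le]). *)

Set Implicit Arguments.
Unset Strict Implicit.
Unset Printing Implicit Defensive.
Local Open Scope classical_set_scope.
Local Open Scope card_scope.

(** * Cardinals *)

Lemma card_leP_fun {T} {U : pointedType} (A : set T) (B : set U) :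
  A #<= B <-> exists2 f : T -> U, set_fun A B f & set_inj A f.
Proof. by rewrite -injfunPex; split => [/pcard_leP|/pcard_leP]. Qed.

(** Consider sets of selectors of [P] that differ pairwise on every member of
    [P].  A maximal such set [M] must exhaust some member [A], as otherwise a
    further selector could be added.  Then [A] is an image of [M], while [M]
    embeds in each member by evaluation. *)
Lemma exists_least_card {T} (P : set (set T)) :
  P !=set0 -> exists A, attains_least_card P A.
Proof.
elim/Ppointed: T => T in P *.
  by move=> [A PA]; exists A; split=> // B _; exact: card_le_emptyl.
move=> P0.
pose sel (M : set (set T -> T)) :=
  (forall m, M m -> forall A, P A -> A (m A)) /\
  (forall m m', M m -> M m' -> m <> m' -> forall A, P A -> m A <> m' A).
have [F FP Ftot|M [[MA Mneq] Mmax]] := @Zorn_bigcup _ sel.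
  split=> [m [M FM Mm]|m m' [M FM Mm] [M' FM' Mm']].
    exact: (FP _ FM).1.
  have [MM'|MM'] := Ftot _ _ FM FM'.
    by apply: (FP _ FM').2 => //; exact: MM'.
  by apply: (FP _ FM).2 => //; exact: MM'.
have [A PA Asur] : exists2 A, P A & forall a, A a -> exists2 m, M m & m A = a.
  apply: contrapT => nA.
  have /choice[m0 m0P] : forall A, exists a, P A ->
      A a /\ forall m, M m -> m A <> a.
    move=> A; have [PA|nPA] := pselect (P A); last by exists point.
    apply: contrapT => na; apply: nA; exists A => // a Aa.
    apply: contrapT => nm; apply: na; exists a => _; split=> // m Mm mA.
    by apply: nm; exists m.
  have [A0 PA0] := P0.
  apply: (Mmax (M `|` [set m0]) _ _); first split.
  - by move=> m Mm; left.
  - by move=> /(_ m0 (or_intror erefl)) Mm0; exact: (m0P _ PA0).2 Mm0 _.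
  - split=> [m [Mm|->] A PA|m m' [Mm|->] [Mm'|->] neq A PA //].
    + exact: (MA _ Mm _ PA).
    + exact: (m0P _ PA).1.
    + exact: (Mneq _ _ Mm Mm' neq _ PA).
    + exact: ((m0P _ PA).2 _ Mm).
    + by move=> e; exact: ((m0P _ PA).2 _ Mm' (esym e)).
exists A; split=> // B PB; apply: (@card_le_trans _ _ _ M).
  apply: (card_le_trans _ (card_image_le (fun m => m A) M)).
  by apply: subset_card_le => a /Asur[m Mm <-]; exists m.
apply/card_leP_fun; exists (fun m => m B) => [m Mm|]; first exact: (MA _ Mm _ PB).
move=> m m' /set_mem Mm /set_mem Mm' /= e; apply: contrapT => neq.
exact: (Mneq _ _ Mm Mm' neq _ PB).
Qed.

Lemma card_le_total {T} (A B : set T) : A #<= B \/ B #<= A.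
Proof.
have [|X [[->|->] X_min]] := @exists_least_card T [set A; B].
- by exists A; left.
- by left; apply: X_min; right.
- by right; apply: X_min; left.
Qed.

Lemma same_least_card_of_le {T U} (P : set (set T)) (Q : set (set U)) :
  P !=set0 ->
  (forall A, P A -> exists2 B, Q B & B #<= A) ->
  (forall B, Q B -> exists2 A, P A & A #<= B) ->
  same_least_card P Q.
Proof.
move=> /exists_least_card[A [PA A_min]] PQ QP.
have [B QB BA] := PQ _ PA.
have A_le B' : Q B' -> A #<= B'.
  by move=> /QP[A' /A_min AA' A'B']; exact: card_le_trans A'B'.
exists A, B; split => //.
- by split=> // B' /A_le; exact: card_le_trans.
- by rewrite card_eq_le A_le.
Qed.

Lemma card_setU_le {T : pointedType} (X Y B : set T) b0 b1 :
  B b0 -> B b1 -> b0 <> b1 -> B `*` B #<= B -> X #<= B -> Y #<= B ->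
  X `|` Y #<= B.
Proof.
move=> Bb0 Bb1 b01 BB /card_leP_fun[f fB finj] /card_leP_fun[g gB ginj].
apply: card_le_trans BB.
apply/card_leP_fun.
exists (fun a => if pselect (X a) then (b0, f a) else (b1, g a)).
  by move=> a XYa /=; case: pselect XYa => Xa [Xa'|Ya]; split => //=;
    [exact: fB|exact: fB|exact: gB].
move=> a a' /set_mem XYa /set_mem XYa'.
case: pselect XYa => Xa XYa; case: pselect XYa' => Xa' XYa' [].
- by apply: finj; apply: mem_set.
- by move=> /b01.
- by move=> /esym/b01.
- by case: XYa => // Ya; case: XYa' => // Ya'; apply: ginj; apply: mem_set.
Qed.

Lemma card_setX_le {T U : Type} {V W : pointedType} (A : set T) (B : set U)
    (C : set V) (D : set W) : A #<= C -> B #<= D -> A `*` B #<= C `*` D.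
Proof.
move=> /card_leP_fun[f fC finj] /card_leP_fun[g gD ginj].
apply/card_leP_fun; exists (fun p => (f p.1, g p.2)) => [p [Ap Bp]|].
  by split; [exact: fC|exact: gD].
move=> [a b] [a' b'] /set_mem[/= Aa Bb] /set_mem[/= Aa' Bb'] [faa' gbb'].
by congr pair; [apply: finj|apply: ginj] => //; apply: mem_set.
Qed.

(** The product of an infinite cardinal with itself is obtained by Zorn's lemma
    from injections of [B `*` B] into [B], for [B `<=` A].  They are represented
    by their graphs so that the union of a chain is a plain union of sets; the
    domain [B] is recovered as [square_field]. *)
Section square.
Variables (T : pointedType) (A : set T).

Definition square_field (G : set ((T * T) * T)) : set T :=
  [set b | exists c, G ((b, b), c)].

Definition square_injection (G : set ((T * T) * T)) : Prop :=
  [/\ forall p c c', G (p, c) -> G (p, c') -> c = c',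
      forall p p' c, G (p, c) -> G (p', c) -> p = p',
      forall a b c, G ((a, b), c) ->
        [/\ square_field G a, square_field G b & square_field G c],
      forall a b, square_field G a -> square_field G b ->
        exists c, G ((a, b), c) &
      square_field G `<=` A].

Definition square_graph (B : set T) (f : T * T -> T) : set ((T * T) * T) :=
  [set q | (B `*` B) q.1 /\ q.2 = f q.1].

Lemma square_graph_field B f : square_field (square_graph B f) = B.
Proof.
apply/seteqP; split=> [b [c [[]]]//|b Bb].
by exists (f (b, b)).
Qed.

Lemma square_injection_graph (B : set T) (f : T * T -> T) :
  B `<=` A -> set_fun (B `*` B) B f -> set_inj (B `*` B) f ->
  square_injection (square_graph B f).
Proof.
move=> BA fB finj; split; rewrite ?square_graph_field//.
- by move=> p c c' [_ /= ->] [_ /= ->].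
- move=> p p' c [/= Bp ->] [/= Bp'] e.
  by apply: finj => //; apply: mem_set.
- by move=> a b c [/= Bab ->]; split; [case: Bab|case: Bab|exact: fB].
- by move=> a b Ba Bb; exists (f (a, b)).
Qed.

Lemma square_injection_fun G : square_injection G ->
  exists2 f, set_fun (square_field G `*` square_field G) (square_field G) f &
    set_inj (square_field G `*` square_field G) f /\
    square_graph (square_field G) f = G.
Proof.
move=> [Gfun Ginj Gfld Gtot GA].
pose f p := xget point [set c | G (p, c)].
have fG a b : square_field G a -> square_field G b -> G ((a, b), f (a, b)).
  by move=> Ba Bb; rewrite /f; have [c Gc] := Gtot _ _ Ba Bb;
    exact: (@xgetI _ point [set c | G ((a, b), c)] c Gc).
exists f => [[a b] [/= Ba Bb]|].
  by have [] := Gfld _ _ _ (fG _ _ Ba Bb).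
split=> [[a b] [a' b'] /set_mem[/= Ba Bb] /set_mem[/= Ba' Bb'] e|].
  by apply: Ginj (fG _ _ Ba Bb) _; rewrite e; exact: (fG _ _ Ba' Bb').
apply/seteqP; split=> [[[a b] c] [[/= Ba Bb] ->]|[[a b] c] Gabc].
  exact: (fG _ _ Ba Bb).
have [Ba Bb _] := Gfld _ _ _ Gabc.
by split=> //=; exact: Gfun Gabc (fG _ _ Ba Bb).
Qed.

Lemma square_injection_bigcup (F : set (set ((T * T) * T))) :
  F `<=` square_injection -> total_on F subset ->
  square_injection (\bigcup_(G in F) G).
Proof.
move=> FP Ftot.
have common G G' : F G -> F G' -> exists2 H, F H & G `<=` H /\ G' `<=` H.
  by move=> FG FG'; have [GG'|G'G] := Ftot _ _ FG FG';
    [exists G'; last split|exists G; last split].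
split.
- move=> p c c' [G FG Gp] [G' FG' Gp'].
  have [H FH [GH G'H]] := common _ _ FG FG'.
  by have [Hfun _ _ _ _] := FP _ FH; apply: Hfun (GH _ Gp) (G'H _ Gp').
- move=> p p' c [G FG Gp] [G' FG' Gp'].
  have [H FH [GH G'H]] := common _ _ FG FG'.
  by have [_ Hinj _ _ _] := FP _ FH; apply: Hinj (GH _ Gp) (G'H _ Gp').
- move=> a b c [G FG Gabc]; have [_ _ Gfld _ _] := FP _ FG.
  have [[a' Ga] [b' Gb] [c' Gc]] := Gfld _ _ _ Gabc.
  by split; [exists a'|exists b'|exists c']; exists G.
- move=> a b [a' [G FG Ga]] [b' [G' FG' Gb]].
  have [H FH [GH G'H]] := common _ _ FG FG'.
  have [_ _ _ Htot _] := FP _ FH.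
  have [||c Hc] := Htot a b; [by exists a'; exact: GH|by exists b'; exact: G'H|].
  by exists c, H.
- move=> a [c [G FG Gac]]; have [_ _ _ _ GA] := FP _ FG.
  by apply: GA; exists c.
Qed.

(** If the complement of [B] holds a copy [C] of [B], then pairs from
    [B `|` C] outside [B `*` B] can be sent injectively into [C]: the union has
    the size of [B], so these pairs embed in [B], hence in [C]. *)
Lemma square_injection_extend (B : set T) (f : T * T -> T) :
  infinite_set B -> B `<=` A -> set_fun (B `*` B) B f ->
  set_inj (B `*` B) f -> B #<= A `\` B ->
  exists2 G, square_injection G & square_graph B f `<` G.
Proof.
move=> Binf BA fB finj /card_leP_fun[g gAB ginj].
have BB : B `*` B #<= B by apply/card_leP_fun; exists f.
have [e eB einj] : exists2 e : nat -> T, set_fun setT B e & set_inj setT e.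
  by apply/card_leP_fun/infiniteP.
pose C := g @` B.
have [h hB hinj] : exists2 h : T -> T, set_fun (B `|` C) B h & set_inj (B `|` C) h.
  apply/card_leP_fun; apply: (@card_setU_le _ _ _ _ (e 0%N) (e 1%N)) => //.
  - exact: eB.
  - exact: eB.
  - by move=> /einj; rewrite !inE => /(_ I I).
  - exact: card_image_le.
pose k p := f (h p.1, h p.2).
have kB p : ((B `|` C) `*` (B `|` C)) p -> B (k p).
  by move=> [p1 p2]; apply: fB; split; apply: hB.
pose F p := if pselect ((B `*` B) p) then f p else g (k p).
have FBC : set_fun ((B `|` C) `*` (B `|` C)) (B `|` C) F.
  move=> p Dp; rewrite /F; case: pselect => [Bp|nBp]; first by left; exact: fB.
  by right; exists (k p) => //; exact: kB.
have Finj : set_inj ((B `|` C) `*` (B `|` C)) F.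
  move=> p q /set_mem Dp /set_mem Dq; rewrite /F.
  case: pselect => Bp; case: pselect => Bq.
  - by apply: finj; apply: mem_set.
  - by rewrite /= => e1; have [_ []] := gAB _ (kB _ Dq); rewrite -e1; exact: fB.
  - by rewrite /= => e1; have [_ []] := gAB _ (kB _ Dp); rewrite e1; exact: fB.
  - move=> /ginj; rewrite !inE => /(_ (kB _ Dp) (kB _ Dq)) /finj.
    rewrite !inE => kpq; case: p q Dp Dq {Bp Bq} kpq => [p1 p2] [q1 q2].
    move=> [/= Dp1 Dp2] [/= Dq1 Dq2] kpq.
    have [h1 h2] : (h p1, h p2) = (h q1, h q2).
      by apply: kpq; split; exact: hB.
    by congr pair; apply: hinj => //; rewrite inE.
exists (square_graph (B `|` C) F).
  apply: square_injection_graph => // a [/BA//|[b Bb <-]].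
  by have [] := gAB _ Bb.
split=> [q [Bq q2]|].
  split; first by case: Bq => ? ?; split; left.
  by rewrite /F; case: pselect.
move=> sub; have Be := eB 0%N I; have [_ nB] := gAB _ Be.
apply: nB.
have : square_graph (B `|` C) F ((g (e 0%N), g (e 0%N)), F (g (e 0%N), g (e 0%N))).
  by split=> //; split; right; exists (e 0%N).
by move=> /sub[[]].
Qed.

End square.

(** For a maximal injection of [B `*` B] into [B], comparability leaves two
    cases.  If [B #<= A `\` B] the injection extends; otherwise [A] is covered
    by two sets of size at most that of [B], so it has the size of [B]. *)
Lemma card_square_le {T : Type} (A : set T) : infinite_set A -> A `*` A #<= A.
Proof.
elim/Ppointed: T => T in A *; first by rewrite emptyE => /(_ (finite_set0 _)).
move=> Ainf.
have [e eA einj] : exists2 e : nat -> T, set_fun setT A e & set_inj setT e.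
  by apply/card_leP_fun/infiniteP.
pose E := e @` setT.
have EA : E `<=` A by move=> _ [n _ <-]; exact: eA.
have Einf : infinite_set E.
  by apply/infiniteP/card_leP_fun; exists e => // n _; exists n.
have [f0 f0E f0inj] : exists2 f, set_fun (E `*` E) E f & set_inj (E `*` E) f.
  apply/card_leP_fun; apply: (@card_le_trans _ _ _ [set: nat]).
    rewrite -(card_le_eqr card_nat2) -setXTT.
    by apply: card_setX_le; exact: card_image_le.
  exact/infiniteP.
(* Requiring a countable square inside every nonempty graph keeps the maximal
   one from being the injection of a point; the empty chain forces [set0]. *)
have [F FP Ftot|G [[Ginj G0] Gmax]] := @Zorn_bigcup _
    [set G | square_injection A G /\ (G = set0 \/ square_graph E f0 `<=` G)].
  split; first by apply: square_injection_bigcup => // G /FP[].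
  have [allN|] := pselect (forall G, F G -> G = set0).
    by left; rewrite -subset0 => q [G /allN ->].
  move=> /existsNP[G /not_implyP[FG GN0]]; right.
  have [_ [//|EG]] := FP _ FG.
  by move=> q /EG Gq; exists G.
have {G0} EG : square_graph E f0 `<=` G.
  case: G0 => // G0; exfalso; apply: (Gmax (square_graph E f0) _ _).
    rewrite G0; split=> // /(_ ((e 0%N, e 0%N), f0 (e 0%N, e 0%N))); apply.
    by split => //; split; exists 0%N.
  by split; [exact: square_injection_graph|right].
have [f fB [finj fG]] := square_injection_fun Ginj.
set B := square_field G in fB finj fG.
have EB : E `<=` B.
  by move=> b Eb; exists (f0 (b, b)); apply: EG.
have Binf : infinite_set B by apply: sub_infinite_set EB Einf.
have BA : B `<=` A by case: Ginj.
have BB : B `*` B #<= B by apply/card_leP_fun; exists f.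
have [AB|BAB] := card_le_total (A `\` B) B; last first.
  have [G' G'inj GG'] := square_injection_extend Binf BA fB finj BAB.
  exfalso; apply: (Gmax G' _ _); first by rewrite -fG.
  split=> //; right; rewrite fG in GG'.
  by apply: subset_trans EG _; case: GG'.
have {}AB : A #<= B.
  rewrite -(setDUK BA); apply: (@card_setU_le _ _ _ _ (e 0%N) (e 1%N)) => //.
  - by apply: EB; exists 0%N.
  - by apply: EB; exists 1%N.
  - by move=> /einj; rewrite !inE => /(_ I I).
apply: card_le_trans (subset_card_le BA).
by apply: card_le_trans BB; exact: card_setX_le.
Qed.
(** * Meager sets of the Cantor space *)

Definition cylinder (z : nat -> bool) (l : nat) : set cantor_space :=
  [set y | forall i, i < l -> y i = z i].

Lemma cylinder_sub z l l' : l <= l' -> cylinder z l' `<=` cylinder z l.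
Proof. by move=> ll' y yz i il; apply: yz; exact: leq_trans ll'. Qed.

Lemma nbhs_cylinder (z : cantor_space) l : nbhs z (cylinder z l).
Proof.
elim: l => [|l IHl]; first by apply: filterS filterT => y _ i.
have zl : nbhs z [set y : cantor_space | y l = z l].
  exact: (@proj_continuous _ (fun _ : nat => bool) l z _ (discrete_set1 (z l))).
apply: filterS (filterI IHl zl) => y [yz yl] i.
by rewrite ltnS leq_eqVlt => /predU1P[->|/yz].
Qed.

Lemma nbhs_sub_cylinder (z : cantor_space) U :
  nbhs z U -> exists l, cylinder z l `<=` U.
Proof.
pose F : set_system cantor_space := filter_from setT (cylinder z).
have FF : Filter F.
  apply: filter_from_filter; first by exists 0%N.
  move=> l l' _ _; exists (maxn l l') => // y yz; split; apply: cylinder_sub yz.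
  - exact: leq_maxl.
  - exact: leq_maxr.
suff Fz : F --> z by move=> /Fz[l _ lU]; exists l.
apply/cvg_sup => i V [_ [[W _ <-] Wz] WV].
exists i.+1 => // y yz; apply: WV => /=.
by rewrite [y i]yz.
Qed.

(** A finite condition is a pair [z, l] standing for the restriction of [z] to
    the first [l] bits. *)
Lemma nowhere_denseP (A : set cantor_space) : nowhere_dense A <->
  forall z l, exists z' l', [/\ l <= l', cylinder z l z' &
    forall y, cylinder z' l' y -> ~ A y].
Proof.
split=> [A0 z l|H].
  apply: contrapT => nz'.
  suff : interior (closure A) z by rewrite A0.
  apply: filterS (nbhs_cylinder z l) => z' zz' B /nbhs_sub_cylinder[l' Bl'].
  apply: contrapT => AB; apply: nz'; exists z', (maxn l l').
  split=> [|//|y yz' Ay]; first exact: leq_maxl.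
  apply: AB; exists y; split=> //; apply: Bl'.
  by apply: cylinder_sub yz'; exact: leq_maxr.
rewrite /nowhere_dense -subset0 => z /nbhs_sub_cylinder[l Al].
have [z' [l' [ll' zz' nA]]] := H z l.
have [y [Ay yz']] := Al _ zz' _ (nbhs_cylinder z' l').
exact: nA yz' Ay.
Qed.

Lemma meagerP (A : set cantor_space) :
  meager A <-> exists2 F : nat -> set cantor_space,
    forall n, nowhere_dense (F n) & A `<=` \bigcup_n F n.
Proof.
split=> [[F F0 ->]|[F F0 AF]]; first by exists F.
exists (fun n => F n `&` A) => [n|]; last first.
  by rewrite -setI_bigcupl; symmetry; apply/setIidPr.
apply/nowhere_denseP => z l.
have [z' [l' [ll' zz' nF]]] := (nowhere_denseP _).1 (F0 n) z l.
by exists z', l'; split=> // y yz' [Fy _]; exact: nF yz' Fy.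
Qed.

(** The intervals start at every [m], not only at the points of a partition, so
    that an interval partition need not be carried along with [u]. *)
Definition evading (x : nat -> bool) (u : nat -> nat) : set cantor_space :=
  [set y | exists m0, forall m, m0 <= m ->
     exists2 i, m <= i < u m & y i <> x i].

Definition agree_on (l l' : nat) (x y : nat -> bool) :=
  forall i, l <= i < l' -> y i = x i.

(** A single block [p.2] on [[l, p.1)] avoids finitely many nowhere dense sets
    whatever the first [l] bits are: there are only finitely many pairs of
    an initial segment and a set to treat, and the block is lengthened for each
    of them in turn. *)
Lemma nowhere_dense_block (F : nat -> set cantor_space) (l n : nat) :
  (forall m, nowhere_dense (F m)) ->
  exists p : nat * (nat -> bool), l < p.1 /\
    forall y, agree_on l p.1 p.2 y -> forall m, m <= n -> ~ F m y.
Proof.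
move=> F0.
have tasks (s : seq (seq bool * nat)) : exists p : nat * (nat -> bool),
    l < p.1 /\ forall y, agree_on l p.1 p.2 y -> forall m,
      (mkseq y l, m) \in s -> ~ F m y.
  elim: s => [|[t m] s [[l1 w] /= [ll1 H1]]].
    by exists (l.+1, fun=> false); split.
  pose z i := if i < l then nth false t i else w i.
  have [z' [l' [l1l' zz' nF]]] := (nowhere_denseP _).1 (F0 m) z l1.
  exists (l', z'); split=> [|y yz' m']; first exact: leq_trans ll1 l1l'.
  rewrite inE => /predU1P[[yt ->]|]; last first.
    apply: H1 => i /andP[li il1].
    rewrite yz' ?li ?(leq_trans il1)//= zz'//.
    by rewrite /z ltnNge li.
  apply: nF => i il'; have [li|il] := leqP l i; first by apply: yz'; rewrite li.
  have il1 : i < l1 by exact: ltn_trans ll1.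
  by rewrite zz'// /z il -yt nth_mkseq.
have [p [lp Hp]] := tasks
  [seq (tval t, m) | t <- enum {: l.-tuple bool}, m <- iota 0 n.+1].
exists p; split=> // y yp m mn; apply: Hp => //.
apply/allpairsP; exists (Tuple (introT eqP (size_mkseq y l)), m); split=> //.
- by rewrite mem_enum.
- by have := mem_iota 0 n.+1 m; rewrite add0n /= ltnS mn => ->.
Qed.

(** The index of the block of the interval partition [[j k, j k.+1)] that
    contains a given point. *)
Definition block (j : nat -> nat) (i : nat) : nat :=
  xget 0 [set k | j k <= i < j k.+1].

Section block.
Variable j : nat -> nat.
Hypotheses (j0 : j 0 = 0) (jS : forall k, j k < j k.+1).

Lemma partition_lt k k' : k < k' -> j k < j k'.
Proof.
elim: k' => // k' IH; rewrite ltnS leq_eqVlt => /predU1P[->//|/IH].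
by move=> /ltn_trans; apply.
Qed.

Lemma partition_le k k' : k <= k' -> j k <= j k'.
Proof. by rewrite leq_eqVlt => /predU1P[->//|/partition_lt/ltnW]. Qed.

Lemma partition_ge k : k <= j k.
Proof. by elim: k => // k /leq_ltn_trans; apply. Qed.

Lemma blockP i : j (block j i) <= i < j (block j i).+1.
Proof.
suff : exists k, j k <= i < j k.+1 by exact: xgetPex.
elim: i => [|i [k /andP[ki ik]]]; first by exists 0; have := jS 0; rewrite j0.
have [ik'|ik'] := ltnP i.+1 (j k.+1); first by exists k; rewrite ik' (leq_trans ki).
exists k.+1; rewrite ik'; exact: leq_trans (jS _).
Qed.

Lemma block_eq k i : j k <= i < j k.+1 -> block j i = k.
Proof.
have /andP[ji ij] := blockP i => /andP[ki ik].
have kb : k < (block j i).+1.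
  by rewrite ltnNge; apply/negP => /partition_le; rewrite leqNgt (leq_ltn_trans ki ij).
have bk : block j i < k.+1.
  by rewrite ltnNge; apply/negP => /partition_le; rewrite leqNgt (leq_ltn_trans ji ik).
by apply/eqP; rewrite eqn_leq -ltnS bk -ltnS kb.
Qed.

End block.

(** The [k]-th block of [x] is chosen so as to avoid the first [k.+1] of the
    nowhere dense sets, whatever precedes it.  As [m <= j m], the interval
    [[m, j m.+1)] contains the [m]-th block. *)
Lemma meager_evading (A : set cantor_space) : meager A ->
  exists x u, (forall m n, m <= n -> u m <= u n) /\ A `<=` evading x u.
Proof.
move=> [F F0 ->].
have /choice[b bP] : forall p : nat * nat, exists q : nat * (nat -> bool),
    p.1 < q.1 /\ forall y, agree_on p.1 q.1 q.2 y ->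
      forall m, m <= p.2 -> ~ F m y.
  by move=> [l n]; exact: nowhere_dense_block.
pose j := fix j n := if n is n'.+1 then (b (j n', n')).1 else 0.
have jS k : j k < j k.+1 by have [] := bP (j k, k).
pose x i := (b (j (block j i), block j i)).2 i.
exists x, (fun m => j m.+1); split=> [m n mn|y [n _ Fny]].
  exact: partition_le.
exists n => m nm; apply: contrapT => nex.
apply: (bP (j m, m)).2 nm Fny => i /= jij; apply: contrapT => yi.
apply: nex; exists i.
  by case/andP: jij => ji ij; rewrite ij (leq_trans _ ji)// partition_ge.
by rewrite /x (@block_eq j (erefl) jS m).
Qed.
(** * Permutations from points of the Cantor space *)

Lemma infinite_natP (A : set nat) :
  infinite_set A <-> forall m, exists2 n, m <= n & A n.
Proof.
split=> [Ainf m|Aunb /finite_seqP[s As]].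
  apply: contrapT => nA; apply: Ainf; apply: sub_finite_set (finite_II m).
  move=> n An /=; rewrite ltnNge; apply/negP => mn.
  by apply: nA; exists n.
have [n + An] := Aunb (\max_(i <- s) i).+1.
rewrite ltnNge => /negP; apply; apply: (@leq_bigmax_seq _ s xpredT id n) => //.
by have : A n by []; rewrite As.
Qed.

Lemma infinite_sub_image {T U} (h : T -> U) (E : set T) (D : set U) :
  D `<=` h @` E -> infinite_set D -> infinite_set E.
Proof. by move=> DE Dinf /(finite_image h) /(sub_finite_set DE). Qed.

(** Pickling of concrete types computes, so unfolding is blocked to keep codes
    readable as [decode x0 (pickle x)]. *)
Definition decode {T : countType} (x0 : T) (c : nat) : T := odflt x0 (unpickle c).
Arguments decode : simpl never.

Lemma pickle_decodeK (T : countType) (x0 : T) : cancel pickle (decode x0).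
Proof. by move=> x; rewrite /decode pickleK. Qed.

Definition edge (n : nat) : nat * nat := decode (0, 0) n.

Definition incident (e : nat * nat) (a : nat) : bool := (a == e.1) || (a == e.2).

(** Since all earlier listed pairs count, active or not, distinct active pairs
    are disjoint. *)
Definition active (z : nat -> bool) (n : nat) : Prop :=
  z n /\ forall m, m < n -> z m ->
    forall a, incident (edge m) a -> ~~ incident (edge n) a.

Definition swaps (z : nat -> bool) (a b : nat) : Prop :=
  exists2 n, active z n & edge n = (a, b) \/ edge n = (b, a).

Definition matching_perm (z : nat -> bool) (a : nat) : nat :=
  xget a [set b | swaps z a b].

Lemma swaps_sym z a b : swaps z a b -> swaps z b a.
Proof. by move=> [n zn [|] e]; exists n => //; [right|left]. Qed.

Lemma swaps_fun z a b b' : swaps z a b -> swaps z a b' -> b = b'.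
Proof.
move=> [n zn en] [n' zn' en'].
have inc c : edge n = (a, c) \/ edge n = (c, a) -> incident (edge n) a.
  by move=> [] ->; rewrite /incident eqxx ?orbT.
have inc' c : edge n' = (a, c) \/ edge n' = (c, a) -> incident (edge n') a.
  by move=> [] ->; rewrite /incident eqxx ?orbT.
have [nn'|n'n|nn'] := ltngtP n n'.
- by have := zn'.2 _ nn' zn.1 _ (inc _ en); rewrite (inc' _ en').
- by have := zn.2 _ n'n zn'.1 _ (inc' _ en'); rewrite (inc _ en).
by subst n'; destruct en, en'; congruence.
Qed.

Lemma matching_perm_swaps z a b : swaps z a b -> matching_perm z a = b.
Proof.
by move=> ab; apply: xget_unique => // b' /swaps_fun; apply.
Qed.

Lemma matching_permK z : involutive (matching_perm z).
Proof.
move=> a; have [[b ab]|nab] := pselect (exists b, swaps z a b).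
  by rewrite (matching_perm_swaps ab) (matching_perm_swaps (swaps_sym ab)).
suff fix_a : matching_perm z a = a by rewrite !fix_a.
by rewrite /matching_perm; case: xgetP => // b _ ab; case: nab; exists b.
Qed.

(** Given a condition of length [l] and a bound [m], take [a < b] in [x], with
    [a] above [m] and above all the pairs coded below [l].  The code of [(a, b)]
    is then at least [l], and the condition extends by zeros up to that code
    and a one there, which makes [a] a displaced point above [m]. *)
Lemma meager_matching (x : set nat) : infinite_set x ->
  meager [set z : cantor_space | finite_set (displaced_within (matching_perm z) x)].
Proof.
move=> /infinite_natP x_unb; apply/meagerP.
exists (fun m => [set z | forall n, displaced_within (matching_perm z) x n -> n < m]).
  move=> m; apply/nowhere_denseP => z l.
  pose B := m + \sum_(i < l) ((edge i).1 + (edge i).2).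
  have [a Ba xa] := x_unb B.+1; have [b ab xb] := x_unb a.+1.
  have ma : m <= a by apply: leq_trans (ltnW Ba); exact: leq_addr.
  have edge_lt i : i < l -> (edge i).1 + (edge i).2 < a.
    move=> il; apply: leq_ltn_trans Ba; rewrite /B (bigD1 (Ordinal il))//=.
    by rewrite addnCA leq_addr.
  pose n := pickle (a, b).
  have en : edge n = (a, b) by rewrite /edge pickle_decodeK.
  have ln : l <= n.
    rewrite leqNgt; apply/negP => /edge_lt; rewrite en /= ltnNge.
    by rewrite leq_addr.
  exists (fun i => if i < l then z i else i == n), n.+1; split.
  - exact: leq_trans ln _.
  - by move=> i il; rewrite il.
  move=> y yz /(_ a) ; rewrite ltnNge ma => nlt.
  suff : swaps y a b.
    move=> /matching_perm_swaps yab.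
    by apply/notF/nlt; split=> //; rewrite yab// => e; rewrite e ltnn in ab.
  exists n; last by left.
  split; first by rewrite yz// ltnNge ln eqxx.
  move=> i ilt; rewrite yz; last exact: ltn_trans ilt _.
  case: ifPn => [il _|_ /eqP ei]; last by rewrite ei ltnn in ilt.
  have := edge_lt _ il; set e1 := (edge i).1; set e2 := (edge i).2 => lt_a c.
  by rewrite /incident en /=; lia.
move=> z /= zfin; apply: contrapT => nbd; apply: (infinite_natP _).2 zfin => m.
apply: contrapT => nm; apply: nbd; exists m => // n dn.
by rewrite ltnNge; apply/negP => mn; apply: nm; exists n.
Qed.
(** * Guessing functions by permutations *)

(** Two positions per earlier element: its image and its preimage under
    a permutation are both to be guarded against. *)
Definition answers (g : nat -> nat) (s : seq nat) : seq nat :=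
  [seq g (pickle (s, i)) | i <- iota 0 (size s + size s)].

(** The elements of the sparse set, latest first; the offset makes the set
    increasing, hence infinite, for any [g]. *)
Fixpoint history (g : nat -> nat) (k : nat) : seq nat :=
  if k is k'.+1 then
    let s := history g k' in (head 0 s + pickle (answers g s)).+1 :: s
  else [::].

Definition sparse_elt (g : nat -> nat) (k : nat) : nat := head 0 (history g k.+1).

Definition sparse_set (g : nat -> nat) : set nat := range (sparse_elt g).

Definition partial_inverse (p : nat -> nat) (b : nat) : nat :=
  xget 0 [set a | p a = b].

(** At position [i] of the history [s], the permutation assumes that the next
    element is [q], decodes from it the values of [g] at all positions, and
    announces the one at position [i]. *)
Definition guess (p : nat -> nat) (m : nat) : nat :=
  let: (s, i) := decode ([::], 0) m in
  let q := if i < size s then p (nth 0 s i)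
           else partial_inverse p (nth 0 s (i - size s)) in
  nth 0 (decode [::] (q - (head 0 s).+1)) i.

Lemma partial_inverseK p : injective p -> cancel p (partial_inverse p).
Proof. by move=> p_inj a; apply: xget_unique => // b /p_inj. Qed.

Lemma size_history g k : size (history g k) = k.
Proof. by elim: k => //= k ->. Qed.

Lemma mem_history g k i : i < k -> sparse_elt g i \in history g k.
Proof.
elim: k => // k IH; rewrite ltnS leq_eqVlt => /predU1P[->|/IH ik].
  exact: mem_head.
by rewrite inE ik orbT.
Qed.

Lemma sparse_elt_lt g k : sparse_elt g k < sparse_elt g k.+1.
Proof. by rewrite {2}/sparse_elt /= -/(sparse_elt g k) ltnS leq_addr. Qed.

Lemma sparse_elt_inj g : injective (sparse_elt g).
Proof.
have lt i j : i < j -> sparse_elt g i < sparse_elt g j.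
  elim: j => // j IH; rewrite ltnS leq_eqVlt => /predU1P[->|/IH ij].
    exact: sparse_elt_lt.
  exact: ltn_trans (sparse_elt_lt _ _).
move=> i j e; have [/lt|/lt|//] := ltngtP i j; by rewrite e ltnn.
Qed.

Lemma infinite_sparse_set g : infinite_set (sparse_set g).
Proof.
apply/infiniteP/card_leP_fun; exists (sparse_elt g) => [k _|]; first by exists k.
by move=> i j _ _; exact: sparse_elt_inj.
Qed.

Lemma guess_correct p g k i (s := history g k)
    (q := if i < size s then p (nth 0 s i)
          else partial_inverse p (nth 0 s (i - size s))) :
  i < k + k -> q = sparse_elt g k -> g (pickle (s, i)) = guess p (pickle (s, i)).
Proof.
move=> ik qk; rewrite /guess pickle_decodeK /= -/q qk {1}/sparse_elt /= -/s.
rewrite subSS addKn pickle_decodeK /= (nth_map 0) ?size_iota /s ?size_history//.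
by have := nth_iota 0 0 ik; rewrite add0n => ->.
Qed.

(** Each displaced point is determined by the code of a position at which the
    guess is correct, together with the information whether it is the earlier
    or the later of the two elements involved. *)
Lemma guess_displaced p g : injective p ->
  infinite_set (displaced_within p (sparse_set g)) ->
  infinite_set [set n | g n = guess p n].
Proof.
move=> p_inj; set E := [set n | _].
pose h n := sparse_elt g (size (decode ([::] : seq nat, 0) n).1).
pose h' n := partial_inverse p (h (n : nat)).
have sub : displaced_within p (sparse_set g) `<=` h @` E `|` h' @` E.
  move=> n [[i _ <-] ne [j _ ij]].
  have hE k m : h (pickle (history g k, m : nat)) = sparse_elt g k.
    by rewrite /h pickle_decodeK size_history.
  have [lt_ij|lt_ji|e] := ltngtP i j; last by case: ne; rewrite -ij e.
    right; have mem_i := mem_history g lt_ij.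
    set s := history g j in mem_i.
    exists (pickle (s, index (sparse_elt g i) s)); last first.
      by rewrite /h' hE ij partial_inverseK.
    apply: guess_correct; last by rewrite index_mem mem_i nth_index.
    by move: mem_i; rewrite -index_mem size_history => /ltn_addr; apply.
  left; have mem_j := mem_history g lt_ji.
  set s := history g i in mem_j.
  exists (pickle (s, size s + index (sparse_elt g j) s)); last by rewrite hE.
  apply: guess_correct.
    by move: mem_j; rewrite -index_mem size_history ltn_add2l.
  by rewrite ltnNge leq_addr /= addKn nth_index// ij partial_inverseK.
move=> Dinf Efin; apply: Dinf; apply: sub_finite_set sub _.
by rewrite finite_setU; split; exact: finite_image.
Qed.

(** * Guessing on an infinite set of arguments *)

Definition entries (f : nat -> nat) (n : nat) : seq (nat * nat) :=
  decode [::] (f n).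

(** The [n]-th entry is a list of argument-value pairs, of which one with a new
    argument is retained. *)
Fixpoint chosen (f : nat -> nat) (n : nat) : seq (nat * nat) :=
  if n is n'.+1 then
    let old := chosen f n' in
    if [seq q <- entries f n' | q.1 \notin unzip1 old] is q :: _ then q :: old
    else old
  else [::].

Definition selection (f : nat -> nat) (m : nat) : nat :=
  xget 0 [set v | exists n, (m, v) \in chosen f n].

Definition partial_code (g e : nat -> nat) (n : nat) : nat :=
  pickle [seq (e i, g (e i)) | i <- iota 0 n.+1].

Lemma chosenS f n q : q \in chosen f n -> q \in chosen f n.+1.
Proof. by move=> qn /=; case: seq.filter => // q' _; rewrite inE qn orbT. Qed.

Lemma chosen_sub f n n' q : n <= n' -> q \in chosen f n -> q \in chosen f n'.
Proof. by move=> nn' qn; rewrite -(subnK nn'); elim: (n' - n) => //= d /chosenS. Qed.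

Lemma size_chosen f n : size (chosen f n) <= n.
Proof. by elim: n => //= n IH; case: seq.filter => //=; exact: leqW. Qed.

Lemma chosen_fun f n m v v' :
  (m, v) \in chosen f n -> (m, v') \in chosen f n -> v = v'.
Proof.
elim: n => //= n IH.
case E : seq.filter => [|q s] //.
have : q \in [seq q <- entries f n | q.1 \notin unzip1 (chosen f n)].
  by rewrite E mem_head.
rewrite mem_filter => /andP[q_new _].
have new w : (m, w) \in chosen f n -> q.1 <> m.
  by move=> mw qm; move/negP: q_new; apply; rewrite qm; exact: (map_f fst mw).
rewrite !inE => /predU1P[e|mv] /predU1P[e'|mv'].
- by move: e'; rewrite -e; case.
- by have := new _ mv'; rewrite -e.
- by have := new _ mv; rewrite -e'.
- exact: IH.
Qed.

Lemma selectionE f n m v : (m, v) \in chosen f n -> selection f m = v.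
Proof.
move=> mv; apply: xget_unique; first by exists n.
move=> w [n' mw]; apply: (@chosen_fun f (maxn n n') m).
  exact: chosen_sub (leq_maxr _ _) mw.
exact: chosen_sub (leq_maxl _ _) mv.
Qed.

(** If the [n]-th guess is right it lists [n.+1] arguments in the range of [e]
    with their values under [g]; at most [n] arguments have been used before,
    so a correct value at a new argument is retained.  Different [n] retain
    different arguments. *)
Lemma partial_code_agree f g e : injective e ->
  infinite_set [set n | partial_code g e n = f n] ->
  infinite_set [set m | range e m /\ g m = selection f m].
Proof.
move=> e_inj.
pose keys n := unzip1 (chosen f n).
pose h m := xget 0 [set n | m \in keys n.+1 /\ m \notin keys n].
apply: (@infinite_sub_image _ _ h) => n /= en.
have fE : entries f n = [seq (e i, g (e i)) | i <- iota 0 n.+1].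
  by rewrite /entries -en pickle_decodeK.
have [q [q_in q_new q_chosen]] : exists q,
    [/\ q \in entries f n, q.1 \notin keys n & q \in chosen f n.+1].
  rewrite /=; case E : seq.filter => [|q s].
    exfalso; have : size [seq e i | i <- iota 0 n.+1] <= size (keys n).
      apply: uniq_leq_size; first by rewrite map_inj_uniq// iota_uniq.
      move=> _ /mapP[i i_n ->]; apply/negPn/negP => i_new.
      suff : (e i, g (e i)) \in [::] by [].
      by rewrite -E mem_filter i_new fE; exact: map_f.
    rewrite !size_map size_iota ltnNge => /negP; apply; exact: size_chosen.
  exists q; have : q \in q :: s by exact: mem_head.
  by rewrite -E mem_filter => /andP[q_new q_in]; split=> //; exact: mem_head.
move: q_in; rewrite fE => /mapP[i _ qE].
exists (e i).
  split; first by exists i.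
  by move: q_chosen; rewrite qE => /selectionE.
apply: xget_unique => [|n' [i_n' i_n'N]].
  by split; move: q_chosen q_new; rewrite qE // => + _; exact: map_f.
have keys_sub a b m : a <= b -> m \in keys a -> m \in keys b.
  by move=> ab /mapP[r ra ->]; apply: map_f; exact: chosen_sub ra.
rewrite qE /= in q_new.
have i_n1 : e i \in keys n.+1 by rewrite -[e i]/((e i, g (e i)).1) -qE map_f.
have [lt|lt|//] := ltngtP n' n.
  by move/negP: q_new; case; exact: keys_sub i_n'.
by move/negP: i_n'N; case; exact: keys_sub i_n1.
Qed.

(** * Leaving a meager set by two guesses *)

Fixpoint cuts (f : nat -> nat) (k : nat) : nat :=
  if k is k'.+1 then (cuts f k' + \sum_(i < (cuts f k').+1) f i).+1 else 0.

Lemma cutsS f k : cuts f k < cuts f k.+1.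
Proof. by rewrite /= ltnS leq_addr. Qed.

Lemma leq_cutsS f k n : n <= cuts f k -> f n <= cuts f k.+1.
Proof.
move=> nk; apply: leqW; rewrite (bigD1 (Ordinal (nk : n < (cuts f k).+1)))//=.
by rewrite addnCA leq_addr.
Qed.

(** Let [f n = u (u n)] with [n] in the [k]-th block.  If that block is too short,
    it ends before [u n], so [u] of its end is at most [u (u n) = f n], which
    is below the end of the next block. *)
Lemma cuts_long f u : (forall m n, m <= n -> u m <= u n) ->
  infinite_set [set n | u (u n) = f n] ->
  infinite_set [set k | u (cuts f k) <= cuts f k.+1].
Proof.
move=> u_mono /infinite_natP f_hit; apply/infinite_natP => m.
have [n mn un] := f_hit (cuts f m).
have /andP[kn nk] := blockP (erefl : cuts f 0 = 0) (cutsS f) n.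
set k := block _ n in kn nk.
have mk : m <= k.
  rewrite leqNgt; apply/negP => /(partition_le (cutsS f)).
  by rewrite leqNgt (leq_ltn_trans mn nk).
have [ku|ku] := leqP (u (cuts f k)) (cuts f k.+1); first by exists k.
exists k.+1; first exact: leqW.
apply: leq_trans (leq_cutsS (ltnW nk)); rewrite -un.
by apply: (u_mono); apply: leq_trans (ltnW ku) _; exact: u_mono.
Qed.

Definition spliced (f1 f2 : nat -> nat) : cantor_space := fun i =>
  nth false (decode [::] (selection f2 (block (cuts f1) i))) i.

Lemma spliced_not_evading f1 u (x : nat -> bool) :
  (forall m n, m <= n -> u m <= u n) -> infinite_set [set n | u (u n) = f1 n] ->
  exists g, forall f2, infinite_set [set n | g n = f2 n] ->
    ~ evading x u (spliced f1 f2).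
Proof.
move=> u_mono f1_hit; have := cuts_long u_mono f1_hit.
set K := [set k | _] => /infiniteP/card_leP_fun[e eK e_inj].
pose c k := pickle (mkseq x (cuts f1 k.+1)).
exists (partial_code c e) => f2 /partial_code_agree hit [m0 evade].
have [|k m0k [[n _ kE] ck]] := (infinite_natP _).1 (hit _) m0.
  by move=> a b; apply: e_inj; rewrite inE.
have long : u (cuts f1 k) <= cuts f1 k.+1 by rewrite -kE; exact: eK.
have [|i /andP[ki iu]] := evade (cuts f1 k).
  by apply: leq_trans m0k _; exact: (partition_ge (cutsS f1)).
have ik : i < cuts f1 k.+1 by exact: leq_trans iu long.
apply; rewrite /spliced.
rewrite (block_eq (erefl : cuts f1 0 = 0) (cutsS f1) (k := k)) ?ki//.
by rewrite -ck pickle_decodeK nth_mkseq.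
Qed.

(** * The four inequalities *)

Lemma Delta_family_of_nonmeager (N : set cantor_space) : nonmeager_set N ->
  exists2 Pi, Delta_family Pi & Pi #<= N.
Proof.
move=> N_nm; exists (matching_perm @` N); last exact: card_image_le.
split=> [_ [z _ <-]|x x_inf]; first exact: inv_bij (matching_permK z).
apply: contrapT => no_p; apply: N_nm; apply/meagerP.
have /meagerP[F F0 xF] := meager_matching x_inf.
exists F => // z Nz; apply: xF => /=; apply: contrapT => z_inf.
by apply: no_p; exists (matching_perm z) => //; exists z.
Qed.

Lemma meager_cover_of_hatDelta (X : set (set nat)) : hatDelta_family X ->
  exists2 C, meager_cover C & C #<= X.
Proof.
move=> [X_inf X_fin].
pose M (x : set nat) : set cantor_space :=
  [set z | finite_set (displaced_within (matching_perm z) x)].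
exists (M @` X); last exact: card_image_le.
split=> [_ [x /X_inf x_inf <-]|]; first exact: meager_matching.
rewrite -subTset => z _.
have [x Xx z_fin] := X_fin _ (inv_bij (matching_permK z)).
by exists (M x) => //; exists x.
Qed.

(** A finite family makes finitely many guesses at each argument, and
    a function exceeding them all is never guessed. *)
Lemma infinite_Delta_family Pi : Delta_family Pi -> infinite_set Pi.
Proof.
move=> [Pi_bij Pi_disp] Pi_fin.
have /choice[g gP] n : exists b, forall p, Pi p -> guess p n < b.
  have /finite_seqP[s sE] := finite_image (guess^~ n) Pi_fin.
  exists (\max_(i <- s) i).+1 => p Pip; rewrite ltnS.
  apply: (@leq_bigmax_seq _ s xpredT id) => //.
  have : ((guess^~ n) @` Pi) (guess p n) by exists p.
  by rewrite sE.
have [p Pip /(guess_displaced (bij_inj (Pi_bij _ Pip)))] :=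
  Pi_disp _ (@infinite_sparse_set g).
move=> /infinite_setN0[n /= gn].
by have := gP n p Pip; rewrite -gn ltnn.
Qed.

Lemma nonmeager_of_Delta_family (Pi : set (nat -> nat)) : Delta_family Pi ->
  exists2 N, nonmeager_set N & N #<= Pi.
Proof.
move=> PiD; have Pi_inf := infinite_Delta_family PiD.
have predicted g : exists2 p, Pi p & infinite_set [set n | g n = guess p n].
  have [Pi_bij Pi_disp] := PiD.
  have [p Pip p_disp] := Pi_disp _ (@infinite_sparse_set g).
  by exists p => //; apply: guess_displaced p_disp; exact: bij_inj (Pi_bij _ Pip).
pose y (pq : (nat -> nat) * (nat -> nat)) := spliced (guess pq.1) (guess pq.2).
exists (y @` (Pi `*` Pi)); last first.
  exact: card_le_trans (card_image_le _ _) (card_square_le Pi_inf).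
move=> /meager_evading[x [u [u_mono yE]]].
have [p Pip /(spliced_not_evading x u_mono)[g gP]] := predicted (fun n => u (u n)).
have [q Piq gq] := predicted g.
by apply: gP gq (yE _ _); exists (p, q).
Qed.

(** If no family of size at most that of [C] witnessed hatDelta, any functions
    indexed by [C] could be guessed simultaneously.  Two such guesses give
    a point that no member of [C] contains. *)
Lemma hatDelta_of_meager_cover (C : set (set cantor_space)) : meager_cover C ->
  exists2 X, hatDelta_family X & X #<= C.
Proof.
move=> [C_meager C_cover]; apply: contrapT => no_X.
have predicted (g : set cantor_space -> nat -> nat) :
    exists f, forall A, C A -> infinite_set [set n | g A n = f n].
  apply: contrapT => no_f; apply: no_X.
  exists ((sparse_set \o g) @` C); last exact: card_image_le.
  split=> [_ [A _ <-]|p p_bij]; first exact: infinite_sparse_set.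
  apply: contrapT => no_x; apply: no_f; exists (guess p) => A CA.
  apply: guess_displaced; first exact: bij_inj.
  move=> fin; apply: no_x; exists (sparse_set (g A)) => //.
  by exists A.
have /choice[xu xuP] A : exists q : (nat -> bool) * (nat -> nat), C A ->
    (forall m n, m <= n -> q.2 m <= q.2 n) /\ A `<=` evading q.1 q.2.
  have [/C_meager /meager_evading[x [u xuA]]|nCA] := pselect (C A).
    by exists (x, u).
  by exists (xpred0, id).
have [f1 f1P] := predicted (fun A n => (xu A).2 ((xu A).2 n)).
have /choice[g gP] A : exists g, C A ->
    forall f2, infinite_set [set n | g n = f2 n] ->
      ~ evading (xu A).1 (xu A).2 (spliced f1 f2).
  have [CA|nCA] := pselect (C A); last by exists id.
  have [g gP] := spliced_not_evading (xu A).1 (xuP _ CA).1 (f1P _ CA).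
  by exists g.
have [f2 f2P] := predicted g.
have : (\bigcup_(A in C) A) (spliced f1 f2) by rewrite C_cover.
move=> [A CA /(xuP _ CA).2]; exact: gP (f2P _ CA).
Qed.

Lemma nonmeager_setT : nonmeager_set setT.
Proof.
move=> /meager_evading[x [u [_ /(_ x I)[m0 /(_ m0 (leqnn _))[]]]]].
by move=> i _; case.
Qed.

Lemma meager_set1 (z : cantor_space) : meager [set z].
Proof.
apply/meagerP; exists (fun=> [set z]) => [_|y ->]; last by exists 0%N.
apply/nowhere_denseP => w l.
exists (fun i => if i == l then ~~ z l else w i), l.+1; split=> //.
  by move=> i; rewrite ltn_neqAle => /andP[/negPf ->].
move=> y /(_ l (leqnn _)); rewrite eqxx => yl yz.
by move: yl; rewrite yz; case: (z l).
Qed.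

Theorem corollary14 :
  same_least_card Delta_family nonmeager_set /\
  same_least_card hatDelta_family meager_cover.
Proof.
split; apply: same_least_card_of_le.
- by have [Pi] := Delta_family_of_nonmeager nonmeager_setT; exists Pi.
- exact: nonmeager_of_Delta_family.
- exact: Delta_family_of_nonmeager.
- have [|X] := @hatDelta_of_meager_cover (range (@set1 cantor_space)).
    split=> [_ [z _ <-]|]; first exact: meager_set1.
    by rewrite -subTset => z _; exists [set z] => //; exists z.
  by exists X.
- exact: meager_cover_of_hatDelta.
- exact: hatDelta_of_meager_cover.
Qed.
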